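(* Let $G$ be a finite soluble group that can be generated by $k$ elements. Then for every connected component $C$ of the Andrews--Curtis graph $\Delta_k(G/[G,G],G/[G,G])$, the preimage of $C$ in $\Delta_k(G,G)$ (under the map induced by the canonical epimorphism $G\to G/[G,G]$) is connected. In particular, the graph $\Delta_{k+1}(G,G)$ is connected.
   Context: For a group $G$ and an integer $k\geqslant 1$, the Andrews--Curtis graph $\Delta_k(G,G)$ is the undirected graph whose vertices are the $k$-tuples $(h_1,\ldots,h_k)\in G^k$ that generate $G$ as a normal subgroup, i.e. the normal closure $\langle h_1^G,\ldots,h_k^G\rangle$ of $\{h_1,\ldots,h_k\}$ equals $G$. Two vertices are joined by an edge if one is obtained from the other by one of the following moves, each changing only the $i$-th component: $x_i\mapsto x_ix_j^{\pm1}$ ($i\ne j$); $x_i\mapsto x_j^{\pm1}x_i$ ($i\neq j$); $x_i\mapsto x_i^{-1}$; $x_i\mapsto x_i^w=w^{-1}x_iw$ for an arbitrary $w\in G$. An epimorphism $G\to H$ of groups, applied componentwise, induces an adjacency-preserving map of graphs $\Delta_k(G,G)\to\Delta_k(H,H)$; the preimage of a connected component is the subgraph of $\Delta_k(G,G)$ induced on the set of vertices mapped into that component. A graph is connected if any two of its vertices are joined by a path. *)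

(* Defs.v *)
From mathcomp Require Import all_boot all_fingroup all_solvable.

Set Implicit Arguments.
Unset Strict Implicit.
Unset Printing Implicit Defensive.

Local Open Scope group_scope.

Section InducedGraphs.

Variables (T : finType) (e : rel T) (A : {set T}).

(* A graph is given by its vertex set A and a relation e on the ambient type,
   of which only the restriction to A matters. *)
Definition induced : rel T := [rel x y in A | e x y].

Definition connected_graph : Prop := {in A &, forall x y, connect induced x y}.

Definition component (C : {set T}) : Prop :=
  exists2 x, x \in A & C = [set y | connect induced x y].

End InducedGraphs.

Section AndrewsCurtis.

Variables (gT : finGroupType) (k : nat) (G : {set gT}).
Implicit Types h : {ffun 'I_k -> gT}.

Definition ac_vertices : {set {ffun 'I_k -> gT}} :=
  [set h : {ffun 'I_k -> gT} | [forall i, h i \in G]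
           && (<<class_support [set h i | i : 'I_k] G>> == G)].

Definition ac_move (i : 'I_k) h h' : bool :=
  [forall j, (j != i) ==> (h' j == h j)] &&
  [|| [exists j, (j != i) &&
         [|| h' i == h i * h j, h' i == h i * (h j)^-1,
             h' i == h j * h i | h' i == (h j)^-1 * h i]],
      h' i == (h i)^-1
    | [exists w in G, h' i == h i ^ w]].

Definition ac_adj : rel {ffun 'I_k -> gT} :=
  fun h h' => [exists i, ac_move i h h' || ac_move i h' h].

End AndrewsCurtis.

(* The vertices of the preimage of C under the map of Andrews--Curtis graphs
   obtained by applying f componentwise. *)
Definition ac_preimage (aT rT : finGroupType) (k : nat) (f : aT -> rT)
    (G : {set aT}) (C : {set {ffun 'I_k -> rT}}) : {set {ffun 'I_k -> aT}} :=
  [set h in ac_vertices k G | [ffun i => f (h i)] \in C].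

(* Main.v *)
Require Import Defs.
From mathcomp Require Import all_boot all_fingroup all_solvable.

Set Implicit Arguments.
Unset Strict Implicit.
Unset Printing Implicit Defensive.

Local Open Scope group_scope.

(**
Write X_i(x) for the normal closure of the entries of x other than x_i. The
moves allow x_i to be multiplied by any element of X_i(x), and paths lift along
G -> G / N, so one may induct on the order of G along a minimal normal subgroup
N and only has to correct the entries of a tuple by elements of N.

For the first claim take N inside [G, G], and correct a tuple x towards a tuple
g congruent to it modulo N that generates G. If X_i(x) contains N there is
nothing to do. Otherwise X_i(x) centralizes N; if x_i did too, then G / X_i(x)
would be abelian, because g generates G, so X_i(x) would contain [G, G] and
hence N. Thus x_i does not centralize N, and replacing some other x_j by x_j x_i
makes X_i contain N. That a generating g exists above each vertex for G / [G, G]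
is Gaschuetz' lemma.

For the second claim, any k-tuple g that normally generates a finite group G
(soluble or not) makes every vertex x of the (k+1)-graph connected to (g, 1).
Modulo N we may assume x = (g_1 n_1, ..., g_k n_k, n). If n = 1 then
the first k entries normally generate G, so n may be changed to a nontrivial
element of N. The conjugates of n then generate N, so g_1, ..., g_k can be
restored, and finally n is cancelled, since g normally generates G.
*)

(** * Normal closures in a finite group *)

Local Notation ncl A G := <<class_support A G>>.

Lemma mem_ncl (gT : finGroupType) (G : {group gT}) (A : {set gT}) x w :
  x \in A -> w \in G -> x ^ w \in ncl A G.
Proof. by move=> Ax Gw; apply/mem_gen/memJ_class_support. Qed.

Lemma sub_ncl (gT : finGroupType) (G : {group gT}) (A : {set gT}) :
  A \subset ncl A G.
Proof. exact: subset_trans (sub_class_support G A) (subset_gen _). Qed.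

Lemma ncl_min (gT : finGroupType) (G : {group gT}) (A : {set gT})
    (H : {group gT}) :
  A \subset H -> G \subset 'N(H) -> ncl A G \subset H.
Proof. by move=> sAH nHG; rewrite gen_subG class_support_sub_norm. Qed.

Lemma ncl_norm (gT : finGroupType) (G : {group gT}) (A : {set gT}) :
  G \subset 'N(ncl A G).
Proof. by apply/norms_gen/class_support_norm. Qed.

Lemma ncl_sub (gT : finGroupType) (G : {group gT}) (A : {set gT}) :
  A \subset G -> ncl A G \subset G.
Proof. by move=> sAG; rewrite ncl_min ?normG. Qed.

Lemma sub_ncl_quotient (gT : finGroupType) (G N : {group gT})
    (A : {set gT}) :
  G \subset 'N(N) -> A \subset G -> ncl A G / N \subset ncl (A / N) (G / N).
Proof.
move=> nNG sAG; have nNA := subset_trans sAG nNG.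
have sCG: class_support A G \subset G by rewrite class_support_subG.
rewrite quotient_gen ?(subset_trans sCG) // gen_subG.
apply/subsetP=> _ /morphimP[_ _ /imset2P[x w Ax Gw ->] ->].
rewrite morphJ ?(subsetP nNG _ Gw) ?(subsetP nNA _ Ax) //.
apply: (@mem_ncl _ (G / N)%G); last exact: mem_quotient.
by apply: mem_morphim; rewrite ?(subsetP nNA).
Qed.

(** * Moves on tuples, and the multiplications that compose from them *)

Section Moves.

Variables (gT : finGroupType) (k : nat) (G : {group gT}).
Implicit Types (x y : {ffun 'I_k -> gT}) (i j : 'I_k) (v w n : gT).

Local Notation "x ~~> y" := (connect (@ac_adj gT k G) x y) (at level 70).

Definition upd x i v : {ffun 'I_k -> gT} :=
  [ffun j => if j == i then v else x j].

Lemma upd_same x i v : upd x i v i = v.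
Proof. by rewrite ffunE eqxx. Qed.

Lemma upd_id x i : upd x i (x i) = x.
Proof. by apply/ffunP=> j; rewrite ffunE; case: eqP => // ->. Qed.

Lemma upd_other x i v j : j != i -> upd x i v j = x j.
Proof. by rewrite ffunE => /negPf->. Qed.

Lemma upd_upd x i v w : upd (upd x i v) i w = upd x i w.
Proof. by apply/ffunP=> j; rewrite !ffunE; case: eqP. Qed.

Lemma updC x i j v w : i != j -> upd (upd x i v) j w = upd (upd x j w) i v.
Proof.
move=> nij; apply/ffunP=> l; rewrite !ffunE; case: eqP => // ->.
by rewrite eq_sym (negPf nij).
Qed.

Lemma ac_move_eq i x y : ac_move G i x y -> y = upd x i (y i).
Proof.
case/andP=> /forallP same _; apply/ffunP=> j; rewrite ffunE.
by case: eqP => [->|/eqP nji] //; apply/eqP/(implyP (same j)).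
Qed.

Lemma ac_move_upd i x v :
  ac_move G i x (upd x i v) =
    [|| [exists j, (j != i) &&
           [|| v == x i * x j, v == x i * (x j)^-1,
               v == x j * x i | v == (x j)^-1 * x i]],
        v == (x i)^-1 | [exists w in G, v == x i ^ w]].
Proof.
rewrite /ac_move upd_same; case: forallP => //= -[] j.
by apply/implyP=> nji; rewrite upd_other.
Qed.

(** Each kind of move is undone by a move of the same kind at the same index, so an edge can be read
    as a move in either direction. *)
Lemma ac_move_sym i x y : ac_move G i x y -> ac_move G i y x.
Proof.
move=> mxy; have def_y := ac_move_eq mxy; rewrite def_y in mxy *.
set v := y i in mxy *; rewrite ac_move_upd in mxy.
(* [x] is itself an update of [upd x i v], so [ac_move_upd] also describes the way back. *)
rewrite -[X in ac_move _ _ _ X](upd_id x i) -(upd_upd x i v (x i)).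
rewrite ac_move_upd upd_same.
case/or3P: mxy => [/existsP[j /andP[nji]] | /eqP-> | /exists_inP[w Gw /eqP->]].
- move=> mij; apply/or3P/Or31/existsP; exists j; rewrite nji upd_other //=.
  by case/or4P: mij => /eqP->; rewrite ?mulgK ?mulgKV ?mulKg ?mulKVg eqxx ?orbT.
- by rewrite invgK eqxx orbT.
by apply/or3P/Or33/exists_inP; exists w^-1; rewrite ?groupV ?conjgK.
Qed.

Lemma ac_adjP x y : reflect (exists i, ac_move G i x y) (ac_adj G x y).
Proof.
apply: (iffP existsP) => -[i mi]; exists i; last by rewrite mi.
by case/orP: mi => // /ac_move_sym.
Qed.

Lemma ac_adj_sym : symmetric (@ac_adj gT k G).
Proof. by move=> x y; apply/ac_adjP/ac_adjP=> -[i /ac_move_sym]; exists i. Qed.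

Lemma ac_connect_sym : connect_sym (@ac_adj gT k G).
Proof. exact/sym_connect_sym/ac_adj_sym. Qed.

Lemma ac_mul x i j : j != i -> x ~~> upd x i (x i * x j).
Proof.
move=> nji; apply/connect1/ac_adjP; exists i; rewrite ac_move_upd.
by apply/or3P/Or31/existsP; exists j; rewrite nji eqxx.
Qed.

Lemma ac_conj x i w : w \in G -> x ~~> upd x i (x i ^ w).
Proof.
move=> Gw; apply/connect1/ac_adjP; exists i; rewrite ac_move_upd.
by apply/or3P/Or33/exists_inP; exists w.
Qed.

(** Conjugate entry [j] by [w], multiply entry [i] by it, then conjugate entry [j] back. *)
Lemma ac_mul_conj x i j w :
  j != i -> w \in G -> x ~~> upd x i (x i * x j ^ w).
Proof.
move=> nji Gw; have nij: i != j by rewrite eq_sym.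
apply: connect_trans (ac_conj x j Gw) _; set y := upd x j _.
apply: connect_trans (ac_mul y nji) _; set z := upd y i _.
apply: connect_trans (ac_conj z j (groupVr Gw)) _.
have ->: z j = x j ^ w by rewrite /z upd_other // upd_same.
by rewrite /z upd_same upd_other // conjgK updC // /y upd_upd upd_id connect0.
Qed.

Lemma ac_mul_ncl x i n :
  n \in ncl (x @: [set~ i]) G -> x ~~> upd x i (x i * n).
Proof.
(* Asking for the multiplication at every value [v] of entry [i] makes [T] closed under products. It
   contains the conjugates of the other entries, hence their normal closure. *)
pose T := [set n |
  [forall v, connect (@ac_adj gT k G) (upd x i v) (upd x i (v * n))]].
have groupT: group_set T.
  apply/group_setP; split=> [|m m'].
    by rewrite inE; apply/forallP=> v; rewrite mulg1 connect0.
  rewrite !inE => /forallP Tm /forallP Tm'; apply/forallP=> v.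
  by rewrite mulgA; apply: connect_trans (Tm v) (Tm' _).
suffices sT: ncl (x @: [set~ i]) G \subset Group groupT.
  by move/(subsetP sT); rewrite inE => /forallP/(_ (x i)); rewrite upd_id.
rewrite gen_subG; apply/subsetP=> _ /imset2P[_ w /imsetP[j + ->] Gw ->].
rewrite !inE => nji; apply/forallP=> v.
by have:= ac_mul_conj (upd x i v) nji Gw; rewrite upd_upd upd_same upd_other.
Qed.

(** The entries indexed by [Q] are corrected one at a time; the invariant [P] keeps the next
    correction possible. *)
Lemma ac_connect_coords (P : {ffun 'I_k -> gT} -> Prop) (Q : {set 'I_k}) x y :
    (forall z i, P z -> i \in Q -> z ~~> upd z i (y i) /\ P (upd z i (y i))) ->
    P x -> (forall i, i \notin Q -> x i = y i) ->
  x ~~> y.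
Proof.
move=> step Px xyQ'.
pose z (s : seq 'I_k) := [ffun i => if i \in s then y i else x i].
have zP s: {subset s <= Q} -> x ~~> z s /\ P (z s).
  elim: s => [_|i s IHs sQ].
    suffices ->: z [::] = x by split; rewrite ?connect0.
    by apply/ffunP=> i; rewrite ffunE.
  have [|xz Pz] := IHs; first by move=> j sj; rewrite sQ // inE sj orbT.
  have [|zu Pu] := step _ i Pz; first by rewrite sQ ?mem_head.
  have <-: upd (z s) i (y i) = z (i :: s); last first.
    by split=> //; apply: connect_trans zu.
  by apply/ffunP=> j; rewrite !ffunE inE; case: eqP => [->|].
have [|xz _] := zP (enum Q); first by move=> i; rewrite mem_enum.
suffices <-: z (enum Q) = y by [].
by apply/ffunP=> i; rewrite ffunE mem_enum; case: ifPn => // /xyQ'.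
Qed.

Lemma ac_vertexP x :
  reflect ((forall i, x i \in G) /\ ncl [set x i | i : 'I_k] G = G)
          (x \in ac_vertices k G).
Proof.
rewrite inE; apply: (iffP andP) => -[xG defG]; split=> //.
- exact/forallP.
- exact/eqP.
- exact/forallP.
by rewrite defG.
Qed.

Lemma codom_subG x (A : {pred 'I_k}) :
  (forall i, x i \in G) -> [set x i | i in A] \subset G.
Proof. by move=> xG; apply/subsetP=> _ /imsetP[i _ ->]. Qed.

Lemma ac_move_ncl i x y (H : {group gT}) :
    ac_move G i x y -> G \subset 'N(H) -> (forall j, x j \in H) ->
  forall j, y j \in H.
Proof.
move=> mxy nHG xH; have def_y := ac_move_eq mxy.
rewrite def_y ac_move_upd in mxy *.
move=> j; rewrite ffunE; case: eqP => // _.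
case/or3P: mxy => [/existsP[l /andP[_]]|/eqP->|/exists_inP[w Gw /eqP->]].
- by case/or4P=> /eqP->; rewrite groupM ?groupV.
- by rewrite groupV.
by rewrite memJ_norm ?(subsetP nHG).
Qed.

(** Because the move can be reversed, the old entries lie in the normal closure of the new ones. *)
Lemma ac_adj_vertices x y :
  ac_adj G x y -> x \in ac_vertices k G -> y \in ac_vertices k G.
Proof.
case/ac_adjP=> i mxy /ac_vertexP[xG defG]; apply/ac_vertexP.
have yG: forall j, y j \in G by apply: ac_move_ncl mxy (normG G) xG.
split=> //; apply/eqP; rewrite eqEsubset ncl_sub ?codom_subG //=.
rewrite -{1}defG ncl_min ?ncl_norm //; apply/subsetP=> _ /imsetP[j _ ->].
apply: ac_move_ncl (ac_move_sym mxy) (ncl_norm _ _) _ j => j.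
by apply/(subsetP (sub_ncl _ _))/imset_f.
Qed.

Lemma ac_connect_vertices x y :
  x ~~> y -> x \in ac_vertices k G -> y \in ac_vertices k G.
Proof.
move=> xy Vx; have clV: closed (@ac_adj gT k G) (ac_vertices k G).
  by apply: (intro_closed ac_connect_sym) => z t /ac_adj_vertices.
by rewrite -(closed_connect clV xy).
Qed.

End Moves.

(** * Paths among all tuples versus paths in an induced subgraph *)

Lemma connect_induced (T : finType) (e : rel T) (A : {set T}) x y :
    (forall z t, e z t -> z \in A -> t \in A) -> x \in A ->
  connect e x y -> connect (induced e A) x y.
Proof.
move=> clA Ax /connectP[p]; elim: p x Ax => [|z p IHp] x Ax /=.
  by move=> _ ->; apply: connect0.
case/andP=> exz ep def_y; have Az := clA _ _ exz Ax.
apply: connect_trans (IHp z Az ep def_y).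
by apply: connect1; rewrite /induced /= Ax Az.
Qed.

Lemma induced_connect (T : finType) (e : rel T) (A : {set T}) x y :
  connect (induced e A) x y -> connect e x y.
Proof.
apply: connect_sub => z t; rewrite /induced /= -andbA.
by case/and3P=> _ _ /connect1.
Qed.

(** * Tuples modulo a normal subgroup: lifting of paths, and Gaschuetz' lemma *)

Section Quotient.

Variables (gT : finGroupType) (k : nat) (G N : {group gT}).
Hypothesis nNG : G \subset 'N(N).
Implicit Types (x y : {ffun 'I_k -> gT}) (c d : {ffun 'I_k -> coset_of N}).

Definition quo x : {ffun 'I_k -> coset_of N} := [ffun i => coset N (x i)].

Lemma quoP x y :
    (forall i, x i \in G) -> (forall i, y i \in G) -> quo x = quo y ->
  forall i, (x i)^-1 * y i \in N.
Proof.
move=> xG yG /ffunP eqxy i; have := eqxy i; rewrite !ffunE.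
have [nx ny] := (subsetP nNG _ (xG i), subsetP nNG _ (yG i)).
move/esym/(rcoset_kercosetP ny nx); rewrite norm_rlcoset //.
case/lcosetP=> n Nn ->; by rewrite mulKg.
Qed.

Lemma codom_quo x :
  (forall i, x i \in G) -> [set quo x i | i : 'I_k] = [set x i | i : 'I_k] / N.
Proof.
move=> xG; have nNx i: x i \in 'N(N) by apply: (subsetP nNG).
rewrite /quotient morphimEsub; last by apply/subsetP=> _ /imsetP[i _ ->].
by rewrite -imset_comp; apply: eq_imset => i; rewrite ffunE.
Qed.

Lemma quo_gen x : <<[set x i | i : 'I_k]>> = G ->
  <<[set quo x i | i : 'I_k]>> = G / N.
Proof.
move=> genG; have xG i: x i \in G by rewrite -genG mem_gen ?imset_f.
rewrite codom_quo // -quotient_gen ?genG //.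
exact: subset_trans (codom_subG _ xG) nNG.
Qed.

Lemma quo_vertices x :
  x \in ac_vertices k G -> quo x \in ac_vertices k (G / N).
Proof.
case/ac_vertexP=> xG defG.
have qG i: quo x i \in G / N by rewrite ffunE mem_quotient.
apply/(@ac_vertexP _ _ (G / N)%G); split=> //.
apply/eqP; rewrite eqEsubset.
rewrite (@ncl_sub _ (G / N)%G) ?(@codom_subG _ _ (G / N)%G) //=.
by rewrite codom_quo // -{1}defG sub_ncl_quotient ?codom_subG.
Qed.

Lemma ac_move_quo i x y :
    (forall j, x j \in G) -> ac_move G i x y ->
  ac_move (G / N) i (quo x) (quo y).
Proof.
move=> xG mxy; have def_y := ac_move_eq mxy; rewrite def_y in mxy *.
set v := y i in mxy *; rewrite ac_move_upd in mxy.
have nNx j: x j \in 'N(N) by apply: (subsetP nNG).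
have qx j: quo x j = coset N (x j) by rewrite ffunE.
have ->: quo (upd x i v) = upd (quo x) i (coset N v).
  by apply/ffunP=> j; rewrite !ffunE; case: eqP.
rewrite (@ac_move_upd _ _ (G / N)%G) !qx.
case/or3P: mxy =>
  [/existsP[j /andP[nji mij]] | /eqP-> | /exists_inP[w Gw /eqP->]].
- apply/or3P/Or31/existsP; exists j; rewrite nji qx /=.
  by case/or4P: mij => /eqP->; rewrite ?morphM ?morphV ?groupV // eqxx ?orbT.
- by rewrite morphV // eqxx orbT.
apply/or3P/Or33/exists_inP; exists (coset N w); first exact: mem_quotient.
by rewrite morphJ ?(subsetP nNG _ Gw).
Qed.

(** The same formula lifts the move: a multiplication keeps its index [j], and a conjugating element
    is replaced by a preimage in [G]. *)
Lemma ac_move_lift i x c :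
    (forall j, x j \in G) -> ac_move (G / N) i (quo x) c ->
  exists2 y, ac_move G i x y & quo y = c.
Proof.
move=> xG mxc; have def_c := @ac_move_eq _ _ (G / N)%G _ _ _ mxc.
have nNx j: x j \in 'N(N) by apply: (subsetP nNG).
rewrite def_c in mxc *; set d := c i in mxc *.
suffices [v mv <-]: exists2 v, ac_move G i x (upd x i v) & coset N v = d.
  by exists (upd x i v) => //; apply/ffunP=> j; rewrite !ffunE; case: eqP.
have qx j: quo x j = coset N (x j) by rewrite ffunE.
rewrite (@ac_move_upd _ _ (G / N)%G) in mxc.
case/or3P: mxc => [/existsP[j /andP[nji]] | /eqP-> |
  /exists_inP[_ /morphimP[w nNw Gw ->] /eqP->]].
- rewrite !qx => mxd.
  have [v mv qv]: exists2 v,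
      [|| v == x i * x j, v == x i * (x j)^-1,
          v == x j * x i | v == (x j)^-1 * x i] & coset N v = d.
    case/or4P: mxd => /eqP->.
    - by exists (x i * x j); rewrite ?eqxx ?morphM.
    - by exists (x i * (x j)^-1); rewrite ?eqxx ?orbT ?morphM ?morphV ?groupV.
    - by exists (x j * x i); rewrite ?eqxx ?orbT ?morphM.
    by exists ((x j)^-1 * x i); rewrite ?eqxx ?orbT ?morphM ?morphV ?groupV.
  exists v; rewrite // ac_move_upd; apply/or3P/Or31/existsP.
  by exists j; rewrite nji.
- by exists (x i)^-1; rewrite ?qx ?morphV // ac_move_upd eqxx orbT.
exists (x i ^ w); rewrite ?qx ?morphJ // ac_move_upd.
by apply/or3P/Or33/exists_inP; exists w.
Qed.

Lemma ac_connect_lift x c :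
    (forall i, x i \in G) -> connect (@ac_adj _ k (G / N)) (quo x) c ->
  exists y, [/\ connect (@ac_adj _ k G) x y, forall i, y i \in G & quo y = c].
Proof.
move=> xG /connectP[p]; elim: p x xG => [|d p IHp] x xG /=.
  by move=> _ ->; exists x; split; rewrite ?connect0.
case/andP=> /(@ac_adjP _ _ (G / N)%G)[i mxd] pd def_c.
have [y mxy def_d] := ac_move_lift xG mxd; rewrite -def_d in pd def_c.
have yG: forall j, y j \in G := ac_move_ncl mxy (normG G) xG.
have [z [yz zG qz]] := IHp y yG pd def_c; exists z; split=> //.
by apply: connect_trans yz; apply/connect1/ac_adjP; exists i.
Qed.

Let lifts c (H : {group gT}) :=
  [set x : {ffun 'I_k -> gT} | [forall i, x i \in H] && (quo x == c)].
Let gen_lifts c (H : {group gT}) :=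
  [set x in lifts c H | <<[set x i | i : 'I_k]>> == H].

(** Since [H] covers [G / N], the elements of [H] above [c i] form a coset of [H :&: N], and the
    entries are chosen independently. *)
Lemma card_lifts c (H : {group gT}) :
    H \subset G -> H / N = G / N -> (forall i, c i \in G / N) ->
  #|lifts c H| = (#|H :&: N| ^ k)%N.
Proof.
move=> sHG defQ cG; pose F i := [pred a in H | coset N a == c i].
have nNH := subset_trans sHG nNG.
have cardF i: #|F i| = #|H :&: N|.
  have: c i \in H / N by rewrite defQ.
  case/morphimP=> a nNa Ha def_c; rewrite -(card_rcoset _ a).
  apply: eq_card => b; rewrite !inE mem_rcoset def_c inE groupMr ?groupV //.
  case Hb: (b \in H) => //=; have nNb := subsetP nNH _ Hb.
  by rewrite -mem_rcoset; apply/eqP/rcoset_kercosetP.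
have ->: #|lifts c H| = #|family F|.
  apply: eq_card => x; rewrite inE.
  apply/andP/familyP => [[/forallP xH /eqP qx] i|xF].
    by rewrite inE xH -qx ffunE eqxx.
  split; first by apply/forallP=> i; case/andP: (xF i).
  by apply/eqP/ffunP=> i; rewrite ffunE; apply/eqP; case/andP: (xF i).
rewrite card_family /image_mem -[in RHS](size_enum_ord k).
by elim: (enum _) => //= i s ->; rewrite cardF expnS.
Qed.

(* By induction on [#|H|]: if [H] covers [G / N], the numbers of lifts that
   generate the various subgroups of [H] add up to [#|H :&: N| ^ k], which does
   not depend on the tuple being lifted. *)
Lemma card_gen_lifts c d (H : {group gT}) :
    <<[set c i | i : 'I_k]>> = G / N -> <<[set d i | i : 'I_k]>> = G / N ->
  H \subset G -> #|gen_lifts c H| = #|gen_lifts d H|.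
Proof.
move=> genc gend; have [n] := ubnP #|H|; elim: n H => // n IHn H leHn sHG.
have covers (e : {ffun 'I_k -> coset_of N}) :
    <<[set e i | i : 'I_k]>> = G / N -> gen_lifts e H != set0 ->
  H / N = G / N.
  move=> gene /set0Pn[x]; rewrite !inE.
  case/andP=> /andP[/forallP xH /eqP qx] /eqP genx.
  rewrite -gene -qx -{1}genx codom_quo; last by move=> i; apply: (subsetP sHG).
  rewrite quotient_gen // (subset_trans (codom_subG _ xH)) //.
  exact: subset_trans sHG nNG.
(* If [H] does not cover [G / N], no lift of a generating tuple can generate [H], and both counts
   are 0. *)
have [defQ | nQ] := eqVneq (H / N) (G / N); last first.
  have nocover (e : {ffun 'I_k -> coset_of N}) :
      <<[set e i | i : 'I_k]>> = G / N -> gen_lifts e H = set0.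
    by move=> gene; apply/eqP; apply: contraNT nQ => /(covers e gene)->.
  by rewrite !nocover.
have split_lifts (e : {ffun 'I_k -> coset_of N}) :
    <<[set e i | i : 'I_k]>> = G / N ->
    (#|gen_lifts e H| + \sum_(K : {group gT} | K \proper H) #|gen_lifts e K| =
     #|H :&: N| ^ k)%N.
  move=> gene; rewrite -(@card_lifts e H) //; last first.
    by move=> i; rewrite -gene mem_gen ?imset_f.
  rewrite -[RHS]sum1_card.
  rewrite (partition_big (fun x => <<[set x i | i : 'I_k]>>%G)
    (fun K : {group gT} => K \subset H)) /=; last first.
    by move=> x; rewrite inE => /andP[/forallP xH _];
      rewrite gen_subG codom_subG.
  rewrite [RHS](bigD1 H) //=; congr (_ + _)%N.
    by rewrite -sum1_card; apply: eq_bigl => x; rewrite inE.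
  apply: eq_big => [K|K]; first by rewrite properEneq andbC.
  move=> /proper_sub sKH; rewrite -sum1_card; apply: eq_bigl => x.
  rewrite !inE -[_%G == K]val_eqE /= andbAC [RHS]andbAC; congr (_ && _).
  case: eqP; rewrite ?andbF // => genx; rewrite !andbT.
  have xK: forall i, x i \in K by move=> i; rewrite -genx mem_gen ?imset_f.
  by apply/forallP/forallP=> // _ i; apply: (subsetP sKH).
have := split_lifts c genc; rewrite -(split_lifts d gend).
rewrite (eq_bigr (fun K : {group gT} => #|gen_lifts d K|)); first by move/addIn.
move=> K ltKH; apply: IHn; last exact: subset_trans (proper_sub ltKH) sHG.
exact: leq_trans (proper_card ltKH) leHn.
Qed.

(** The tuples [c] and [quo x] have equally many generating lifts, and [x] is one for [quo x]. *)
Lemma gaschuetz x c :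
    <<[set x i | i : 'I_k]>> = G -> <<[set c i | i : 'I_k]>> = G / N ->
  exists2 y : {ffun 'I_k -> gT}, <<[set y i | i : 'I_k]>> = G & quo y = c.
Proof.
move=> genx genc; have genq := quo_gen genx.
have: #|gen_lifts c G| != 0%N.
  rewrite (card_gen_lifts genc genq) // -lt0n; apply/card_gt0P; exists x.
  rewrite !inE genx !eqxx !andbT; apply/forallP=> i.
  by rewrite -genx mem_gen ?imset_f.
rewrite -lt0n => /card_gt0P[y]; rewrite !inE.
by case/andP=> /andP[_ /eqP qy] /eqP geny; exists y.
Qed.

End Quotient.

(** * Minimal normal subgroups against normalized subgroups *)

Lemma minnormal_sub (gT : finGroupType) (G N Y : {group gT}) :
  minnormal N G -> G \subset 'N(Y) -> N :&: Y != 1 -> N \subset Y.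
Proof.
case/mingroupP=> /andP[_ nNG] minN nYG ntNY; apply/setIidPl.
by apply: (minN (N :&: Y)%G); rewrite ?subsetIl // ntNY normsI.
Qed.

(** The commutator of [N] and [Y] lies in [N :&: Y], so it vanishes when this intersection is
    trivial. *)
Lemma minnormal_sub_or_cent (gT : finGroupType) (G N Y : {group gT}) :
    minnormal N G -> N \subset G -> Y \subset G -> G \subset 'N(Y) ->
  (N \subset Y) || (Y \subset 'C(N)).
Proof.
move=> minN sNG sYG nYG; have /andP[_ nNG] := mingroupp minN.
have [tiNY|/(minnormal_sub minN nYG)->//] := eqVneq (N :&: Y) 1.
apply/orP; right; apply/commG1P/trivgP; rewrite -tiNY setIC.
by rewrite commg_subI // subsetI subxx ?(subset_trans sYG) ?(subset_trans sNG).
Qed.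

(** * Correcting a tuple by elements of a minimal normal subgroup [N] *)

Section ChiefStep.

Variables (gT : finGroupType) (k : nat) (G N : {group gT}).
Hypotheses (minN : minnormal N G) (sNG : N \subset G).
Implicit Types (g x y : {ffun 'I_k -> gT}).

Local Notation "x ~~> y" := (connect (@ac_adj gT k G) x y) (at level 70).

(** The entry [x j] keeps the normal closure of the entries other than [x i] from centralizing [N],
    so this closure contains [N]. *)
Lemma ac_mul_witness x i j n :
    (forall l, x l \in G) -> j != i -> x j \notin 'C(N) -> n \in N ->
  x ~~> upd x i (x i * n).
Proof.
move=> xG nji ncx Nn; apply: ac_mul_ncl.
have sAG := codom_subG [in [set~ i]] xG.
have := minnormal_sub_or_cent minN sNG (ncl_sub sAG) (ncl_norm _ _).
case/orP=> [/subsetP->//|/subsetP/(_ (x j))/implyP/idPn[]].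
rewrite negb_imply ncx andbT; apply/(subsetP (sub_ncl _ _))/imset_f.
by rewrite !inE.
Qed.

Hypotheses (solG : solvable G) (sNG' : N \subset G^`(1)).

Lemma ac_mul_chief g x i n :
    <<[set g j | j : 'I_k]>> = G ->
    (forall j, x j \in G) -> (forall j, (x j)^-1 * g j \in N) -> n \in N ->
  x ~~> upd x i (x i * n).
Proof.
move=> genG xG xg Nn; have Gn := subsetP sNG n Nn.
have [_ ntN abN] := minnormal_solvable minN sNG solG.
have {abN}cNN: abelian N by case/is_abelemP: abN => p _ /abelem_abelian.
have cn: n \in 'C(N) by apply: (subsetP cNN).
have sXG := ncl_sub (codom_subG [in [set~ i]] xG).
pose X := ncl (x @: [set~ i]) G.
have nXG: G \subset 'N(X) := ncl_norm _ _.
have [sNX|nsNX] := boolP (N \subset X); first exact/ac_mul_ncl/(subsetP sNX).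
have ncxi: x i \notin 'C(N).
  apply: contra nsNX => cxi; apply: subset_trans sNG' _.
  (* If [x i] centralizes [N], then [H] is abelian. Each [g j] is [x j] times an element of [N], so
     [X] and [H] generate [G]; thus [G / X] is abelian and [X] contains the derived subgroup. *)
  pose H := <[x i]> <*> N.
  have sHG: H \subset G by rewrite join_subG cycle_subG xG.
  have abH: abelian H.
    by rewrite abelianY cycle_abelian cNN centsC cycle_subG.
  apply: der1_min => //; apply: abelianS (quotient_abelian X abH).
  rewrite -(quotientYidl (subset_trans sHG nXG)) quotientS //.
  rewrite -[in X in X \subset _]genG gen_subG.
  apply/subsetP=> _ /imsetP[j _ ->].
  rewrite -(mulKVg (x j) (g j)) groupM //.
    have [->|nji] := eqVneq j i.
      by apply/(subsetP (joing_subr X H))/(subsetP (joing_subl _ N))/cycle_id.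
    apply/(subsetP (joing_subl X H))/(subsetP (sub_ncl _ _))/imset_f.
    by rewrite !inE.
  by apply/(subsetP (joing_subr X H))/(subsetP (joing_subr <[x i]> _))/xg.
(* With [i] as the only index, [G] would be cyclic, against [N] being nontrivial inside the derived
   subgroup. *)
have [j nji | noj] := pickP (predC1 i); last first.
  case/negP: ntN; rewrite -subG1 (subset_trans sNG') //.
  suffices /derG1P->: abelian G by [].
  suffices <-: <[g i]> = G by apply: cycle_abelian.
  rewrite -[RHS]genG; congr <<_>>; apply/setP=> a; rewrite inE.
  apply/eqP/imsetP=> [->|[j _ ->]]; first by exists i.
  by move/(_ j): noj; rewrite /= => /negbFE/eqP->.
have nij: i != j by rewrite eq_sym.
have updG (z : {ffun 'I_k -> gT}) l v :
  (forall l', z l' \in G) -> v \in G -> forall l', upd z l v l' \in G.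
  by move=> zG Gv l'; rewrite ffunE; case: eqP.
pose y := upd x j (x j * x i).
have yG: forall l, y l \in G by apply: updG; rewrite ?groupM.
have xy: x ~~> y by apply: ac_mul.
(* Either [x j] is a witness, or it centralizes [N] and then [y j = x j * x i] is one. *)
have [cxj|ncxj] := boolP (x j \in 'C(N)); last exact: ac_mul_witness ncxj Nn.
have ncyj: y j \notin 'C(N) by rewrite upd_same groupMl.
have yt := ac_mul_witness yG nji ncyj Nn.
(* The rest of the path is traced back from the target [u]. Multiplying its entry [j] by [x i * n]
   gives [x j * x i * n]; the surplus [n] is removed with entry [i] as witness, since [n]
   centralizes the abelian group [N] and [x i] does not. *)
pose u := upd x i (x i * n).
have uG: forall l, u l \in G by apply: updG; rewrite ?groupM.
apply: connect_trans xy (connect_trans yt _); rewrite ac_connect_sym.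
apply: connect_trans (ac_mul G u nij) _; set u' := upd u j _.
have u'G: forall l, u' l \in G by apply: updG; rewrite ?groupM.
have ncu'i: u' i \notin 'C(N) by rewrite upd_other // upd_same groupMr.
have <-: upd u' j (u' j * n^-1) = upd y i (y i * n); last first.
  exact: ac_mul_witness u'G nij ncu'i (groupVr Nn).
apply/ffunP=> l; rewrite !ffunE !eqxx (negPf nij) (negPf nji) mulgA mulgK.
by have [->|] := eqVneq l j; rewrite ?(negPf nji).
Qed.

Lemma ac_connect_chief g x :
    <<[set g j | j : 'I_k]>> = G ->
    (forall j, x j \in G) -> (forall j, (x j)^-1 * g j \in N) ->
  x ~~> g.
Proof.
move=> genG xG xg; have gG i: g i \in G by rewrite -genG mem_gen ?imset_f.
pose P x := (forall j, x j \in G) /\ (forall j, (x j)^-1 * g j \in N).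
apply: (ac_connect_coords (P := P) (Q := [set: 'I_k]));
  last by move=> i; rewrite inE.
  move=> z i [zG zg] _; split.
    by rewrite -(mulKVg (z i) (g i)); exact: ac_mul_chief genG zG zg (zg i).
  by split=> j; rewrite ffunE; case: eqP => // ->; rewrite mulVg.
by [].
Qed.

End ChiefStep.

(** Induction on the order of [G]. The hypotheses pass to [G / N], whose derived subgroup is the
    image of that of [G]; the lifted path ends at a tuple congruent to [g] modulo [N], where the
    chief step applies. *)
Lemma ac_connect_der (gT : finGroupType) (k : nat) (G : {group gT})
    (g x : {ffun 'I_k -> gT}) :
    solvable G -> <<[set g i | i : 'I_k]>> = G -> (forall i, x i \in G) ->
    (forall i, (x i)^-1 * g i \in G^`(1)) ->
  connect (@ac_adj gT k G) x g.
Proof.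
have [m] := ubnP #|G|.
elim: m gT G g x => // m IHm gT G g x leG solG genG xG xg.
have gG i: g i \in G by rewrite -genG mem_gen ?imset_f.
have [G'1|ntG'] := eqVneq G^`(1) 1.
  suffices ->: x = g by apply: connect0.
  apply/ffunP=> i; have:= xg i; rewrite G'1 => /set1gP/(canRL (mulKVg _)).
  by rewrite mulg1.
have [N minN sNG'] := minnormal_exists ntG' (der_norm 1 G).
have sNG := subset_trans sNG' (der_sub 1 G).
have [nNG ntN _] := minnormal_solvable minN sNG solG.
have ltQ: #|G / N| < m by exact: leq_trans (ltn_quotient ntN sNG) leG.
have qxqg: connect (@ac_adj _ k (G / N)) (quo N x) (quo N g).
  apply: (IHm _ (G / N)%G) => //; first exact: quotient_sol.
  - exact: quo_gen.
  - by move=> i; rewrite ffunE mem_quotient.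
  move=> i; rewrite !ffunE -quotient_der // -morphV ?(subsetP nNG) //.
  by rewrite -morphM ?groupV ?(subsetP nNG) // mem_quotient.
have [y [xy yG qy]] := ac_connect_lift nNG xG qxqg.
apply: connect_trans xy (ac_connect_chief minN sNG solG sNG' genG yG _).
exact (quoP nNG yG gG qy).
Qed.

(** * Tuples with one more entry *)

Section Stabilization.

Variables (gT : finGroupType) (k : nat).

(** The base point for the second claim: [unlift] fails only at the last index, where the default 1
    is taken. *)
Definition ext (g : {ffun 'I_k -> gT}) : {ffun 'I_k.+1 -> gT} :=
  [ffun i => oapp g 1 (unlift ord_max i)].

Lemma ext_max g : ext g ord_max = 1.
Proof. by rewrite ffunE unlift_none. Qed.

Lemma ext_lift g i : ext g (lift ord_max i) = g i.
Proof. by rewrite ffunE liftK. Qed.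

Lemma ext_vertices (G : {group gT}) g :
  g \in ac_vertices k G -> ext g \in ac_vertices k.+1 G.
Proof.
case/ac_vertexP=> gG defG.
have eG i: ext g i \in G.
  by case: (unliftP ord_max i) => [j ->|->]; rewrite ?ext_lift ?ext_max.
apply/ac_vertexP; split=> //; apply/eqP.
rewrite eqEsubset ncl_sub ?codom_subG //= -{1}defG ncl_min ?ncl_norm //.
apply/subsetP=> _ /imsetP[i _ ->].
apply/(subsetP (sub_ncl _ _))/imsetP.
by exists (lift ord_max i); rewrite ?ext_lift.
Qed.

End Stabilization.

(** A trivial entry adds nothing to the normal closure, so the other entries already normally
    generate [G]. *)
Lemma ac_mul_trivial (gT : finGroupType) (k : nat) (G : {group gT})
    (x : {ffun 'I_k -> gT}) i v :
    x \in ac_vertices k G -> x i = 1 -> v \in G ->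
  connect (@ac_adj gT k G) x (upd x i v).
Proof.
case/ac_vertexP=> xG defG xi1 Gv; rewrite -[v]mul1g -xi1; apply: ac_mul_ncl.
move: v Gv; apply/subsetP; rewrite -{1}defG ncl_min ?ncl_norm //.
apply/subsetP=> _ /imsetP[j _ ->]; have [->|nji] := eqVneq j i.
  by rewrite xi1 group1.
by apply/(subsetP (sub_ncl _ _))/imset_f; rewrite !inE.
Qed.

Lemma ac_connect_ext (gT : finGroupType) (k : nat) (G : {group gT})
    (g : {ffun 'I_k -> gT}) (x : {ffun 'I_k.+1 -> gT}) :
    g \in ac_vertices k G -> x \in ac_vertices k.+1 G ->
  connect (@ac_adj gT k.+1 G) x (ext g).
Proof.
have [m] := ubnP #|G|; elim: m gT G g x => // m IHm gT G g x leG Vg Vx.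
have Ve := ext_vertices Vg; have [eG _] := ac_vertexP _ _ Ve.
have [xG _] := ac_vertexP _ _ Vx.
have [G1|ntG] := eqVneq (G : {set gT}) 1.
  suffices ->: x = ext g by apply: connect0.
  by apply/ffunP=> i; move: (xG i) (eG i); rewrite G1 => /set1gP-> /set1gP->.
have [N minN sNG] := minnormal_exists ntG (normG G).
have /andP[ntN nNG] := mingroupp minN.
have qeq: quo N (ext g) = ext (quo N g).
  apply/ffunP=> i; case: (unliftP ord_max i) => [j ->|->].
    by rewrite ffunE !ext_lift ffunE.
  by rewrite ffunE !ext_max morph1.
have qxqe: connect (@ac_adj _ k.+1 (G / N)) (quo N x) (quo N (ext g)).
  rewrite qeq; apply: (IHm _ (G / N)%G); try exact: quo_vertices.
  exact: leq_trans (ltn_quotient ntN sNG) leG.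
have [y [xy yG qy]] := ac_connect_lift nNG xG qxqe.
have Vy := ac_connect_vertices xy Vx.
have ye i: (y i)^-1 * ext g i \in N := quoP nNG yG eG qy i.
(* A trivial last entry is replaced by a nontrivial element of [N]; the congruence with [ext g]
   survives because the last entry of [ext g] is 1. *)
have [z [yz ze ntz]]: exists z, [/\ connect (@ac_adj _ k.+1 G) y z,
    forall i, (z i)^-1 * ext g i \in N & z ord_max != 1].
  have [y1|nty] := eqVneq (y ord_max) 1; last by exists y; rewrite connect0.
  have [n Nn ntn] := trivgPn _ ntN; exists (upd y ord_max n).
  split; last by rewrite upd_same.
    by rewrite ac_mul_trivial // (subsetP sNG).
  move=> i; rewrite [upd _ _ _ _]ffunE; case: eqP => // ->.
  by rewrite ext_max mulg1 groupV.
apply: connect_trans xy (connect_trans yz _).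
have Nz: z ord_max \in N by have:= ze ord_max; rewrite ext_max mulg1 groupV.
set n := z ord_max in ntz Nz.
(* The path goes through the tuple of the entries of [g] followed by [n], which is adjusted to
   [ext g] at the end. *)
apply: (@connect_trans _ _ (upd (ext g) ord_max n)); last first.
  by rewrite ac_connect_sym ac_mul_trivial ?ext_max // (subsetP sNG).
(* Keeping the last entry equal to [n] makes the normal closure of the entries other than [t i] meet
   [N] nontrivially, hence contain [N]. *)
pose P (t : {ffun 'I_k.+1 -> gT}) :=
  t ord_max = n /\ forall i, (t i)^-1 * ext g i \in N.
apply: (ac_connect_coords (P := P) (Q := [set~ ord_max])); last first.
- by move=> i; rewrite !inE negbK => /eqP->; rewrite upd_same.
- by [].
move=> t i [tn te]; rewrite !inE => ni; rewrite upd_other //; split.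
  rewrite -[ext g i](mulKVg (t i)); apply: ac_mul_ncl; apply: subsetP (te i).
  apply: (minnormal_sub minN (ncl_norm _ _)); apply/trivgPn; exists n => //.
  by rewrite inE Nz (subsetP (sub_ncl _ _)) // -tn imset_f // !inE eq_sym.
split; first by rewrite upd_other // eq_sym.
by move=> j; rewrite [upd _ _ _ _]ffunE; case: eqP => // ->; rewrite mulVg.
Qed.

(** * The abelianization, and assembly of both claims *)

Lemma ac_vertices_abelian (gT : finGroupType) (k : nat) (G : {group gT})
    (x : {ffun 'I_k -> gT}) :
  abelian G -> x \in ac_vertices k G -> <<[set x i | i : 'I_k]>> = G.
Proof.
move=> abG /ac_vertexP[xG defG]; have sxG := codom_subG 'I_k xG.
apply/eqP; rewrite eqEsubset gen_subG sxG -{1}defG ncl_min ?subset_gen //.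
by rewrite sub_abelian_norm ?gen_subG.
Qed.

Theorem theorem5p12 (gT : finGroupType) (G : {group gT}) (k : nat)
    (k_gt0 : (0 < k)%N) (solG : solvable G)
    (genG : exists g : {ffun 'I_k -> gT}, <<[set g i | i : 'I_k]>> = G) :
  (forall C : {set {ffun 'I_k -> coset_of [~: G, G]}},
     component (@ac_adj _ k (G / [~: G, G])) (ac_vertices k (G / [~: G, G])) C ->
     connected_graph (@ac_adj _ k G)
       (ac_preimage (coset [~: G, G]) G C))
  /\ connected_graph (@ac_adj _ k.+1 G) (ac_vertices k.+1 G).
Proof.
case: genG => g genG; split; last first.
  have Vg: g \in ac_vertices k G.
    have gG i: g i \in G by rewrite -genG mem_gen ?imset_f.
    apply/ac_vertexP; split=> //; apply/eqP; rewrite eqEsubset.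
    by rewrite ncl_sub ?codom_subG //= -{1}genG gen_subG sub_ncl.
  move=> x y Vx Vy; apply: connect_induced => //.
    by move=> z t; apply: ac_adj_vertices.
  apply: connect_trans (ac_connect_ext Vg Vx) _.
  by rewrite ac_connect_sym ac_connect_ext.
pose D := [~: G, G]%G; have nDG: G \subset 'N(D) by apply: commg_norml.
move=> _ [c0 Vc0 ->] x y /setIdP[Vx]; rewrite inE => c0x /setIdP[Vy].
rewrite inE => c0y.
have [[xG _] [yG _]] := (ac_vertexP _ _ Vx, ac_vertexP _ _ Vy).
(* The preimage is closed under moves, because moves map to moves and [C] is a component; a path
   among all tuples therefore suffices. *)
apply: connect_induced => [z t zt /setIdP[Vz]||].
- rewrite inE => c0z; have Vt := ac_adj_vertices zt Vz; rewrite !inE in Vt *.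
  rewrite Vt; apply: connect_trans c0z (connect1 _).
  rewrite /induced /= (quo_vertices nDG Vz).
  rewrite (quo_vertices nDG (ac_adj_vertices zt Vz)).
  have [zG _] := ac_vertexP _ _ Vz; have [i mzt] := ac_adjP _ _ _ zt.
  by apply/(@ac_adjP _ _ (G / D)%G); exists i; apply: ac_move_quo.
- by apply/setIdP; split=> //; rewrite inE.
have qxy: connect (@ac_adj _ k (G / D)) (quo D x) (quo D y).
  apply: (@connect_trans _ _ c0); last exact: induced_connect c0y.
  by rewrite (@ac_connect_sym _ _ (G / D)%G); apply: induced_connect c0x.
have [z [xz zG qz]] := ac_connect_lift nDG xG qxy.
(* In the abelian group [G / D] a vertex generates in the ordinary sense, so a generating tuple [h]
   lies above [quo D y]. Both [z] and [y] are congruent to [h] modulo [D], and [h] joins them. *)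
have [|h genh qh] := gaschuetz nDG genG (c := quo D y).
  apply: (@ac_vertices_abelian _ _ (G / D)%G); last exact: quo_vertices.
  exact: sub_der1_abelian.
have hG i: h i \in G by rewrite -genh mem_gen ?imset_f.
apply: connect_trans xz _; apply: (@connect_trans _ _ h).
  by apply: ac_connect_der => // i; apply: (quoP nDG zG hG); rewrite qz qh.
rewrite ac_connect_sym; apply: ac_connect_der => // i.
exact: (quoP nDG yG hG).
Qed.
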